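(* Let $S$ be a tight script with cell sets $\mathcal{C}_k$ ($k\ge 0$) and skeleton given by the maps $\mathrm{b}$ on the cells. Then every minimal script with the same skeleton as $S$ is equivalent to $S$.
   Context: Scripts. A script is a chain complex of free $\mathbb{Z}$-modules $0\leftarrow \mathcal{M}_{-1}=\mathbb{Z}\xleftarrow{\partial}\mathcal{M}_0\xleftarrow{\partial}\mathcal{M}_1\xleftarrow{\partial}\cdots$ with $\partial\circ\partial=0$, where for $k\ge 0$ the module $\mathcal{M}_k$ is the free $\mathbb{Z}$-module on a given set $\mathcal{C}_k$, whose elements are called $k$-cells (points for $k=0$, lines for $k=1$, planes for $k=2$). The generator $1$ of $\mathcal{M}_{-1}$ is called the accumulator, and we put $\mathcal{C}_{-1}=\{1\}$ and $\mathcal{M}_{-2}=0$. Elements of $\mathcal{M}_k$ are $k$-chains (finite integer combinations of $k$-cells). The support $\operatorname{supp} C$ of a chain $C$ is the set of cells occurring in it with nonzero coefficient, and $\mathrm{b}(C):=\operatorname{supp}(\partial C)\subset\mathcal{C}_{k-1}$ for a $k$-chain $C$. Skeleton. The skeleton (geometrical offprint) of a script is the data of the cell sets $\mathcal{C}_k$ together with the maps assigning to each $k$-cell $C$ ($k\ge0$) the set $\mathrm{b}(C)\subset\mathcal{C}_{k-1}$. Two scripts have the same skeleton if they have the same cell sets and the same sets $\mathrm{b}(C)$ for all cells $C$. Tightness. For $\mathcal{U}\subset\mathcal{C}_k$, $\mathcal{Z}_k(\mathcal{U})$ denotes the module of $k$-chains $C$ with $\operatorname{supp} C\subset\mathcal{U}$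 and $\partial C=0$. A $k$-cell $C$ ($k\ge 0$) is tight if $\partial C\neq 0$ and the $\mathbb{Z}$-module $\mathcal{Z}_{k-1}(\mathrm{b}(C))$ is generated by the single element $\partial C$. A script is tight if each of its cells is tight. Minimality. A $k$-cell $C$ with $\partial C=\sum_l\lambda_l C^{k-1}_l$ is in minimal state if $\gcd_l(\lambda_l)=1$. A script is minimal if all of its cells are in minimal state. Equivalence. Two scripts are equivalent if one is obtained from the other by renaming cells and by replacing cells $C$ by $C'=\pm C$, with $\partial C'=\pm\partial C$, and correspondingly replacing $C$ by $\pm C'$ in the boundaries of all higher-dimensional cells where it occurs. *)

(* Defs.v *)
From mathcomp Require Import all_boot all_order all_algebra finmap.
From mathcomp Require Export monalg.

Set Implicit Arguments.
Unset Strict Implicit.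
Unset Printing Implicit Defensive.

Import GRing.Theory.
Local Open Scope ring_scope.

(* Linear extension of [f] to the free Z-module {malg int[K]} on [K]. *)
Definition linext (K : choiceType) (V : lmodType int) (f : K -> V)
    (c : {malg int[K]}) : V :=
  \sum_(x <- msupp c) c@_x *: f x.

(* Dimensions are shifted by two: [gcell cell n] is C_(n-2), with C_(-2) empty
   and C_(-1) a singleton, whose element [tt] is the accumulator. *)
Definition gcell (cell : nat -> choiceType) (n : nat) : choiceType :=
  match n with
  | 0 => void
  | 1 => unit
  | k.+2 => cell k
  end.

(* [chain cell n] is M_(n-2); in particular M_(-2) = 0 and M_(-1) = Z. *)
Definition chain (cell : nat -> choiceType) (n : nat) :=
  {malg int[gcell cell n]}.

Definition gbd (cell : nat -> choiceType)
    (bd : forall k, cell k -> chain cell k.+1) (n : nat) :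
    gcell cell n.+1 -> chain cell n :=
  match n with
  | 0 => fun=> 0
  | k.+1 => bd k
  end.

(* The boundary map M_(n-1) -> M_(n-2). *)
Definition boundary (cell : nat -> choiceType)
    (bd : forall k, cell k -> chain cell k.+1) (n : nat) :
    chain cell n.+1 -> chain cell n :=
  linext (@gbd cell bd n).

Record script (cell : nat -> choiceType) := Script {
  bd : forall k, cell k -> chain cell k.+1;
  boundary_boundary : forall n (c : chain cell n.+2),
    boundary bd (boundary bd c) = 0
}.

(* The set b(C). *)
Definition bset (cell : nat -> choiceType) (S : script cell) (k : nat)
    (C : cell k) : {fset gcell cell k.+1} :=
  msupp (bd S C).

Definition same_skeleton (cell : nat -> choiceType) (S T : script cell) : Prop :=
  forall k (C : cell k), bset S C = bset T C.

(* Membership in the module Z_(n-1)(U) of cycles supported in [U]. *)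
Definition cycles (cell : nat -> choiceType) (S : script cell) (n : nat)
    (U : gcell cell n.+1 -> Prop) (c : chain cell n.+1) : Prop :=
  (forall x, x \in msupp c -> U x) /\ boundary (bd S) c = 0.

Definition tight_cell (cell : nat -> choiceType) (S : script cell) (k : nat)
    (C : cell k) : Prop :=
  bd S C <> 0 /\
  forall c : chain cell k.+1,
    cycles S (fun x => x \in bset S C) c <-> exists m : int, c = m *: bd S C.

Definition tight (cell : nat -> choiceType) (S : script cell) : Prop :=
  forall k (C : cell k), tight_cell S C.

Definition minimal_cell (cell : nat -> choiceType) (S : script cell) (k : nat)
    (C : cell k) : Prop :=
  \big[gcdz/0]_(x <- bset S C) (bd S C)@_x = 1.

Definition minimal (cell : nat -> choiceType) (S : script cell) : Prop :=
  forall k (C : cell k), minimal_cell S C.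

Definition grename (cell cell' : nat -> choiceType)
    (f : forall k, cell k -> cell' k) (n : nat) :
    gcell cell n -> gcell cell' n :=
  match n with
  | 0 => id
  | 1 => id
  | k.+2 => f k
  end.

Definition gflip (cell : nat -> choiceType) (e : forall k, cell k -> bool)
    (n : nat) : gcell cell n -> bool :=
  match n with
  | 0 => fun=> false
  | 1 => fun=> false
  | k.+2 => e k
  end.

(* Each cell x occurring in a chain is replaced by (-1)^(e x) (f x); the
   accumulator is left fixed. *)
Definition rename_chain (cell cell' : nat -> choiceType)
    (f : forall k, cell k -> cell' k) (e : forall k, cell k -> bool) (n : nat) :
    chain cell n -> chain cell' n :=
  linext (fun x => << (-1) ^+ @gflip cell e n x *g @grename cell cell' f n x >>).

(* [T] is obtained from [S] by renaming each cell C to [f C], changing its sign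
   when [e C] holds. *)
Definition equivalent (cell cell' : nat -> choiceType)
    (S : script cell) (T : script cell') : Prop :=
  exists (f : forall k, cell k -> cell' k) (e : forall k, cell k -> bool),
    (forall k, bijective (f k)) /\
    forall k (C : cell k),
      bd T (f k C) = (-1) ^+ e k C *: rename_chain f e (bd S C).

(* Main.v *)
(** Going up in dimension, signs can be chosen so that flipping cells carries the
    boundary maps of [T] to those of [S].  Once this is done below dimension [k],
    the flipped boundary of a [k]-cell [C] of [T] is a cycle of [S] supported in
    [b(C)], so by tightness it is [m] times the boundary of [C] in [S]; then [m]
    divides all coefficients of the boundary of [C] in [T], and minimality forces
    [m = 1] or [m = -1], which determines the sign of [C]. *)
Require Import Defs.
From mathcomp Require Import all_boot all_order all_algebra finmap.

Set Implicit Arguments.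
Unset Strict Implicit.
Unset Printing Implicit Defensive.

Import GRing.Theory.
Local Open Scope ring_scope.

Section Flip.
Variables (K : choiceType) (s : K -> bool).

(** This is [rename_chain] with the identity renaming, in a single dimension; having [s] as a
    parameter lets [sgn] flip by its own lower values. *)
Definition flip (c : {malg int[K]}) : {malg int[K]} :=
  linext (fun x => << (-1) ^+ s x *g x >>) c.

Lemma mcoeff_flip c x : (flip c)@_x = (-1) ^+ s x * c@_x.
Proof.
rewrite [c in RHS]monalgE /flip /linext !raddf_sum mulr_sumr /=.
apply: eq_bigr => y _; rewrite mcoeffZ !mcoeffU.
by case: eqP => [->|_]; rewrite ?mulr0 // mulrC.
Qed.

Lemma msupp_flip c : msupp (flip c) = msupp c.
Proof.
by apply/fsetP => x; rewrite -!mcoeff_neq0 mcoeff_flip mulf_eq0 signr_eq0.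
Qed.

Lemma flipD c d : flip (c + d) = flip c + flip d.
Proof. by apply/malgP => x; rewrite mcoeffD !mcoeff_flip mcoeffD mulrDr. Qed.

Lemma flipZ a c : flip (a *: c) = a *: flip c.
Proof. by apply/malgP => x; rewrite mcoeffZ !mcoeff_flip mcoeffZ mulrCA. Qed.

Lemma flip0 : flip 0 = 0.
Proof. by apply/malgP => x; rewrite mcoeff_flip mcoeff0 mulr0. Qed.

Lemma linext_flip (V : lmodType int) (f : K -> V) c :
  linext f (flip c) = linext (fun x => (-1) ^+ s x *: f x) c.
Proof.
rewrite /linext msupp_flip; apply: eq_bigr => x _.
by rewrite mcoeff_flip scalerA mulrC.
Qed.

End Flip.

Lemma flip_linext (K L : choiceType) (s : L -> bool) (f : K -> {malg int[L]}) c :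
  flip s (linext f c) = linext (flip s \o f) c.
Proof.
rewrite /linext (big_morph _ (flipD s) (flip0 s)).
by apply: eq_bigr => x _; rewrite flipZ.
Qed.

Lemma linextU (K : choiceType) (V : lmodType int) (f : K -> V) x :
  linext f << 1 *g x >> = f x.
Proof. by rewrite /linext msuppU oner_eq0 big_seq_fset1 mcoeffUU scale1r. Qed.

Lemma dvdz_biggcd (I : eqType) (r : seq I) (F : I -> int) d :
  {in r, forall i, (d %| F i)%Z} -> (d %| \big[gcdz/0]_(i <- r) F i)%Z.
Proof.
move=> dF; rewrite big_seq; elim/big_rec: _ => [|i x ri dx]; first exact: dvdz0.
by rewrite dvdz_gcd dF.
Qed.

Lemma boundary_bd (cell : nat -> choiceType) (S : script cell) k (C : cell k.+1) :
  boundary (bd S) (bd S C) = 0.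
Proof.
by rewrite -[X in boundary _ X](linextU (gbd (bd S) (n := k.+2)) C)
  boundary_boundary.
Qed.

Lemma rename_chain_flip (cell : nat -> choiceType) (e : forall k, cell k -> bool)
    n (c : chain cell n) :
  rename_chain (fun _ => id) e c = flip (gflip e (n := n)) c.
Proof. by case: n c => [|[|n]]. Qed.

Section Signs.
Variables (cell : nat -> choiceType) (S T : script cell).

(** The test only detects that the boundaries disagree; that they are then opposite is proved in
    [bd_flip_cycle]. In the base case the sign is constant because the accumulator is never
    flipped. *)
Fixpoint sgn (k : nat) : cell k -> bool :=
  match k with
  | 0 => fun C => flip (fun=> false) (bd T C) != bd S C
  | k.+1 => fun C => flip (@sgn k) (bd T C) != bd S C
  end.

Lemma sgnE k (C : cell k) :
  sgn C = (flip (@gflip cell sgn k.+1) (bd T C) != bd S C).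
Proof. by case: k C. Qed.

Hypotheses (tightS : tight S) (minT : minimal T) (skelST : same_skeleton S T).

Lemma bd_flip_cycle k (C : cell k) :
  boundary (bd S) (flip (@gflip cell sgn k.+1) (bd T C)) = 0 ->
  bd S C = (-1) ^+ sgn C *: flip (@gflip cell sgn k.+1) (bd T C).
Proof.
move=> bd0; have [_ tightC] := tightS C.
have [m flipE] : exists m, flip (@gflip cell sgn k.+1) (bd T C) = m *: bd S C.
  by apply/tightC; split=> // x; rewrite msupp_flip skelST.
have : (m %| 1%R)%Z.
  rewrite -(minT C); apply: dvdz_biggcd => x _.
  have /(congr1 (mcoeff x)) := flipE; rewrite mcoeff_flip mcoeffZ => eqx.
  by rewrite -[_@_x](signrMK (gflip sgn x)) eqx mulrCA dvdz_mulr.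
rewrite sgnE dvdz1; case: (_ =P bd S C) => [-> _|]; first by rewrite scale1r.
rewrite flipE => neq /eqP m1; rewrite expr1.
(* Only [m = 1] and [m = -1] have absolute value 1, and the former contradicts [neq]. *)
case: m m1 neq {flipE} => [[|[|]]|[|]] // _; first by rewrite scale1r.
by rewrite scalerA scale1r.
Qed.

Lemma bd_flip k (C : cell k) :
  bd S C = (-1) ^+ sgn C *: flip (@gflip cell sgn k.+1) (bd T C).
Proof.
(* For points the cycle condition lives in chains over [void], where any two chains agree. *)
elim: k C => [|k IH] C; apply: bd_flip_cycle; first by apply/malgP; case.
(* Flips intertwine the two boundary maps one dimension down, so the cycle condition reduces to the
   vanishing of the double boundary in [T]. *)
suff -> : boundary (bd S) (flip (@gflip cell sgn k.+2) (bd T C))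
        = flip (@gflip cell sgn k.+1) (boundary (bd T) (bd T C)).
  by rewrite boundary_bd flip0.
rewrite /boundary flip_linext linext_flip; apply: eq_bigr => x _.
(* [IH] brings in a second copy of the sign of [x], and the two cancel. *)
by congr (_ *: _); rewrite [gbd _ x]IH scalerA -expr2 sqrr_sign scale1r.
Qed.

End Signs.

Theorem theorem3p4p3 (cell : nat -> choiceType) (S : script cell) :
  tight S ->
  forall T : script cell,
    minimal T -> same_skeleton S T -> equivalent T S.
Proof.
move=> tightS T minT skelST; exists (fun _ => id), (sgn S T).
split=> [k|k C]; first by exists id.
by rewrite rename_chain_flip; apply: bd_flip.
Qed.
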